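(* Let $n\ge2$ be an integer. There exist $\rho_n\in(0,R_n]$ and coefficients $c_1,c_2,\ldots$ depending only on $n$ such that, for $0<\kappa<\rho_n$, $$\kappa^2=\sum_{\ell=1}^\infty c_\ell\,A_n(\kappa)^{2\ell}.$$ The coefficients are given by the following recursion: setting $b_k=[A_n(\kappa)^2]_{\kappa^{2k}}=\sum_{i+j=k-1}a_ia_j$ (sum over integers $i,j\ge0$), $$c_1=\frac1{b_1}=n^2,\qquad c_\ell=-\frac{1}{b_1^\ell}\sum_{j=1}^{\ell-1}c_j\,\bigl[A_n(\kappa)^{2j}\bigr]_{\kappa^{2\ell}},\quad \ell\ge2,$$ where $[f(\kappa)]_{\kappa^{2\ell}}$ denotes the coefficient of $\kappa^{2\ell}$ in the power series of $f$ at $0$.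
   Context: $I_\nu(\kappa)=\sum_{m\ge0}\frac{(\kappa/2)^{\nu+2m}}{m!\,\Gamma(\nu+m+1)}$ is the modified Bessel function of the first kind. $A_n(\kappa)=I_{n/2}(\kappa)/I_{n/2-1}(\kappa)$ for $\kappa>0$; it extends to a real-analytic odd function on $\mathbb{R}$ with $A_n(0)=0$, whose power series at $0$ is $A_n(\kappa)=\sum_{j\ge0}a_j\kappa^{2j+1}$ with $a_0=1/n$ and $a_j=\frac{-1}{n+2j}\sum_{k=0}^{j-1}a_ka_{j-1-k}$ for $j\ge1$. $R_n>0$ is the radius of convergence of this series. (The paper writes $\zeta=\kappa^2$ and calls it the intensity.) *)

(* Defs.v *)
From Stdlib Require Import Reals Lra Lia Arith.
From Coquelicot Require Import Coquelicot.
Open Scope R_scope.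

Definition Gamma (x : R) : R :=
  RInt_gen (fun t => Rpower t (x - 1) * exp (- t))
           (at_right 0) (Rbar_locally p_infty).

(* [Rpower] is the real power only for a positive base, so [BesselI nu kappa]
   is meaningful for [0 < kappa] only. *)
Definition BesselI (nu kappa : R) : R :=
  Series (fun m => Rpower (kappa / 2) (nu + 2 * INR m)
                   / (INR (fact m) * Gamma (nu + INR m + 1))).

(* I_{n/2} / I_{n/2-1} on the positive half-line, extended to an odd function
   on R; the value at 0 is 0 because [sign 0 = 0]. *)
Definition BesselA (n : nat) (kappa : R) : R :=
  sign kappa * (BesselI (INR n / 2) (Rabs kappa)
                / BesselI (INR n / 2 - 1) (Rabs kappa)).

(* Course-of-values recursion: [a_upto n j i] is the i-th coefficient as soon
   as [i <= j]; lemmas [a_0] and [a_rec] give the defining equations of [a_]. *)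
Fixpoint a_upto (n j : nat) : nat -> R :=
  match j with
  | O => fun _ => 1 / INR n
  | S j' => fun i =>
      if (i <=? j')%nat then a_upto n j' i
      else -1 / (INR n + 2 * INR j)
           * sum_n (fun k => a_upto n j' k * a_upto n j' (j' - k)%nat) j'
  end.

Definition a_ (n j : nat) : R := a_upto n j j.

Lemma a_upto_a (n i j : nat) : (i <= j)%nat -> a_upto n j i = a_ n i.
Proof.
induction j as [|j IH]; intros Hij.
- now replace i with 0%nat by lia.
- destruct (Nat.eq_dec i (S j)) as [->|Hne]; [reflexivity|].
  assert (Hle : (i <= j)%nat) by lia.
  cbn [a_upto]; apply Nat.leb_le in Hle as Hb; rewrite Hb; exact (IH Hle).
Qed.

Lemma a_0 (n : nat) : a_ n 0 = 1 / INR n.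
Proof. reflexivity. Qed.

Lemma a_rec (n j : nat) : (1 <= j)%nat ->
  a_ n j = -1 / (INR n + 2 * INR j)
          * sum_n (fun k => a_ n k * a_ n (j - 1 - k)%nat) (j - 1).
Proof.
destruct j as [|j]; [lia|intros _].
replace (S j - 1)%nat with j by lia.
unfold a_ at 1; cbn [a_upto].
replace (S j <=? j)%nat with false by (symmetry; apply Nat.leb_gt; lia).
f_equal; apply sum_n_ext_loc; intros k Hk.
now rewrite !a_upto_a by lia.
Qed.

(* Radius of convergence of sum_j a_j kappa^(2j+1), as a power series in
   kappa. *)
Definition radius_A (n : nat) : Rbar :=
  CV_radius (fun k => if Nat.odd k then a_ n (Nat.div2 k) else 0).

(* [f]_{kappa^k}: coefficient of kappa^k in the power series of f at 0. *)
Definition coef0 (f : R -> R) (k : nat) : R :=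
  Derive_n f k 0 / INR (fact k).

Definition b_ (n k : nat) : R := coef0 (fun kappa => BesselA n kappa ^ 2) (2 * k).

(* Main.v *)
Require Import Defs.
From Stdlib Require Import Reals Lra Lia Arith.
From Coquelicot Require Import Coquelicot.
Open Scope R_scope.

(** Write z = kappa^2.  With P the power series of I_{n/2-1} stripped of its leading
    power, A = 2 kappa P'(z) / P(z), and Bessel's equation for P turns into a Riccati
    equation for A.  The recursion of the a_j is the same Riccati equation for
    kappa h(z), h(z) = sum_j a_j z^j, so A = kappa h(z) near 0 by uniqueness.  The
    inverse of A has the form kappa = A u(A^2); its differential equation gives a
    recursion for the coefficients of u, whose weighted partial sums stay bounded by
    induction, so u converges.  Uniqueness for a singular linear equation shows that
    it does invert A; hence z = w u(w)^2 for w = A^2, which is the desired expansion.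
    Comparing coefficients of z^l in it yields the recursion of the c_l. *)

(** * The Gamma function on [1, infinity) *)

(** The uniqueness steps concern equations x f' = -g f, singular at 0. For g >= 0 the square f^2
    cannot grow to the right of 0, so f(0) = 0 alone forces f = 0. This argument is one-sided, hence
    the identities in z are proved for z >= 0; that is enough, because z = kappa^2 covers both signs
    of kappa and because a bound for z > 0 suffices to compare coefficients. The equation for u
    comes from kappa = A u(w), w = A^2: there d kappa / dA = u + 2 w u' is the inverse of A' = 1 -
    A^2 - (n - 1) A / kappa, and A / kappa = 1 / u. Clearing the denominator gives (u + 2 w u') (u
    (1 - w) - (n - 1)) = u. Solving it by power series turns the analyticity of the inverse into an
    explicit estimate on a recursion. Apart from lower bounds by explicit constants, no radius of
    convergence is computed: the arguments are about germs at 0. *)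

Lemma is_derive_Rpower (y t : R) : 0 < t ->
  is_derive (fun u => Rpower u y) t (y * Rpower t (y - 1)).
Proof.
intros Ht.
replace (Rpower t (y - 1)) with (Rpower t y / t).
- unfold Rpower; auto_derive; [exact Ht|]; field; lra.
- unfold Rminus; rewrite Rpower_plus, Rpower_Ropp, Rpower_1 by lra; field; lra.
Qed.

Lemma continuous_Gamma_integrand (y t : R) : 0 < t ->
  continuous (fun u => Rpower u y * exp (- u)) t.
Proof.
intros Ht; apply (ex_derive_continuous (fun u => Rpower u y * exp (- u))).
unfold Rpower; auto_derive; exact Ht.
Qed.

Lemma ex_RInt_Gamma_integrand (y a b : R) : 0 < a -> 0 < b ->
  ex_RInt (fun u => Rpower u y * exp (- u)) a b.
Proof.
intros Ha Hb; apply (ex_RInt_continuous (V := R_CompleteNormedModule)).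
intros t Ht; apply continuous_Gamma_integrand.
apply Rlt_le_trans with (2 := proj1 Ht); now apply Rmin_glb_lt.
Qed.

Lemma ln_le_sub1 (u : R) : 0 < u -> ln u <= u - 1.
Proof.
intros Hu; pose proof (exp_ineq1_le (ln u)) as H.
rewrite exp_ln in H by exact Hu; lra.
Qed.

Lemma Gamma_integrand_pos (y t : R) : 0 < Rpower t y * exp (- t).
Proof. apply Rmult_lt_0_compat; apply exp_pos. Qed.

Lemma Gamma_integrand_le (y : R) : 0 <= y ->
  exists C : R, 0 < C /\
    forall t : R, 0 < t -> Rpower t y * exp (- t) <= C * exp (- t / 2).
Proof.
(* From ln (t/c) <= t/c - 1 follows y ln t <= y t/c + y ln c, and c > 2 y makes y t/c at most t/2:
   half of the exponential decay survives. *)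
intros Hy; set (c := 2 * y + 1); exists (exp (y * ln c)).
split; [apply exp_pos|].
intros t Ht; unfold Rpower; rewrite <- !exp_plus.
assert (Hc : 0 < c) by (unfold c; lra).
assert (Hl : ln t <= t / c + ln c).
{ pose proof (ln_le_sub1 (t / c) (Rdiv_lt_0_compat _ _ Ht Hc)) as H.
  unfold Rdiv in H; rewrite ln_mult, ln_Rinv in H
    by first [assumption | now apply Rinv_0_lt_compat].
  unfold Rdiv; lra. }
assert (Hm : y * (t / c) <= t / 2).
{ apply (Rmult_le_reg_r (2 * c)); [lra|].
  replace (y * (t / c) * (2 * c)) with (2 * y * t) by (field; lra).
  replace (t / 2 * (2 * c)) with (t * c) by field.
  unfold c; nra. }
assert (Hle : y * ln t + - t <= y * ln c + - t / 2).
{ assert (y * ln t <= y * (t / c + ln c)) by (apply Rmult_le_compat_l; lra).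
  lra. }
destruct Hle as [Hlt | ->]; [left; now apply exp_increasing | right; reflexivity].
Qed.

Lemma RInt_Gamma_integrand_bounded (y : R) : 0 <= y ->
  exists M : R, forall a b : R, 0 < a <= b ->
    RInt (fun u => Rpower u y * exp (- u)) a b <= M.
Proof.
intros Hy; destruct (Gamma_integrand_le y Hy) as (C & HC & Hle).
exists (2 * C); intros a b [Ha Hab].
assert (HI : is_RInt (fun t => C * exp (- t / 2)) a b
               (minus (- 2 * C * exp (- b / 2)) (- 2 * C * exp (- a / 2)))).
{ apply (is_RInt_derive (V := R_CompleteNormedModule)
           (fun t => - 2 * C * exp (- t / 2))).
  - intros t _; auto_derive; [exact I|]; unfold Rdiv; field.
  - intros t _; apply (ex_derive_continuous (fun t => C * exp (- t / 2))).
    auto_derive; exact I. }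
apply Rle_trans with (RInt (fun t => C * exp (- t / 2)) a b).
- apply RInt_le; [exact Hab | apply ex_RInt_Gamma_integrand; lra
    | eexists; exact HI | intros t Ht; apply Hle; lra].
- rewrite (is_RInt_unique _ _ _ _ HI).
  change minus with Rminus; cbv beta.
  assert (exp (- a / 2) <= 1) by
    (rewrite <- exp_0; left; apply exp_increasing; lra).
  pose proof (exp_pos (- b / 2)); nra.
Qed.

Lemma filter_prod_right_pinfty (a0 b0 : R) (P : R * R -> Prop) : 0 < a0 ->
  (forall a b, 0 < a < a0 -> b0 < b -> P (a, b)) ->
  filter_prod (at_right 0) (Rbar_locally p_infty) P.
Proof.
intros Ha0 HP.
apply (Filter_prod _ _ _ (fun a => 0 < a < a0) (fun b => b0 < b)).
- exists (mkposreal a0 Ha0); intros u Hu Hu0.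
  change (Rabs (u - 0) < a0) in Hu.
  rewrite Rminus_0_r, Rabs_right in Hu; lra.
- now exists b0.
- intros a b Ha Hb; now apply HP.
Qed.

(* The integral over [a, b] grows with [a, b], so the improper integral is its supremum. *)
Lemma is_RInt_gen_Gamma (y : R) : 0 <= y ->
  exists l : R, 0 < l /\
    is_RInt_gen (fun u => Rpower u y * exp (- u))
      (at_right 0) (Rbar_locally p_infty) l.
Proof.
intros Hy; set (f := fun u => Rpower u y * exp (- u)).
destruct (RInt_Gamma_integrand_bounded y Hy) as [M HM]; fold f in HM.
assert (Hex : forall a b, 0 < a -> 0 < b -> ex_RInt f a b)
  by (intros; now apply ex_RInt_Gamma_integrand).
assert (Hnn : forall a b, 0 < a <= b -> 0 <= RInt f a b).
{ intros a b [Ha Hab]; apply RInt_ge_0; [exact Hab | apply Hex; lra|].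
  intros t _; left; apply Gamma_integrand_pos. }
assert (Hmono : forall a a' b b', 0 < a' <= a -> a <= b <= b' ->
          RInt f a b <= RInt f a' b').
{ intros a a' b b' H1 H2.
  rewrite <- (RInt_Chasles f a' a b'), <- (RInt_Chasles f a b b')
    by (apply Hex; lra).
  assert (0 <= RInt f a' a) by (apply Hnn; lra).
  assert (0 <= RInt f b b') by (apply Hnn; lra).
  change plus with Rplus; lra. }
destruct (completeness (fun v => exists a b, 0 < a <= b /\ v = RInt f a b))
  as [l [Hub Hlub]].
- exists M; intros v (a & b & Hab & ->); now apply HM.
- exists (RInt f 1 2), 1, 2; split; [lra | reflexivity].
- exists l; split.
  + apply Rlt_le_trans with (RInt f 1 2).
    * apply RInt_gt_0; [lra | intros; apply Gamma_integrand_pos |].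
      intros t Ht; apply continuous_Gamma_integrand; lra.
    * apply Hub; exists 1, 2; split; [lra | reflexivity].
  + intros P [eps HP].
    assert (Hex2 : exists a b, 0 < a <= b /\ l - eps < RInt f a b).
    { apply Classical_Prop.NNPP; intros Hno.
      pose proof (cond_pos eps) as He.
      enough (l <= l - eps) by lra.
      apply Hlub; intros v (a & b & Hab & ->).
      apply Rnot_lt_le; intros Hlt; apply Hno; exists a, b; tauto. }
    destruct Hex2 as (a0 & b0 & Hab0 & Hl).
    apply filter_prod_right_pinfty with a0 b0; [lra|].
    intros a b Ha Hb; exists (RInt f a b); split.
    * apply (RInt_correct f); apply Hex; simpl; lra.
    * apply HP; change (Rabs (RInt f a b - l) < eps).
      assert (RInt f a b <= l) by (apply Hub; exists a, b; split; [lra | reflexivity]).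
      assert (RInt f a0 b0 <= RInt f a b) by (apply Hmono; lra).
      rewrite Rabs_left1; lra.
Qed.

(** [RInt_gen] is a total function, so [Gamma x] is the improper integral only once convergence is
    known. For x >= 1 the integrand stays bounded near 0. *)
Lemma is_RInt_gen_Gamma_value (x : R) : 1 <= x ->
  is_RInt_gen (fun t => Rpower t (x - 1) * exp (- t))
    (at_right 0) (Rbar_locally p_infty) (Gamma x).
Proof.
intros Hx; destruct (is_RInt_gen_Gamma (x - 1)) as (l & _ & Hl); [lra|].
unfold Gamma; rewrite (is_RInt_gen_unique _ _ Hl); exact Hl.
Qed.

Lemma Gamma_pos (x : R) : 1 <= x -> 0 < Gamma x.
Proof.
intros Hx; destruct (is_RInt_gen_Gamma (x - 1)) as (l & Hl0 & Hl); [lra|].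
unfold Gamma; now rewrite (is_RInt_gen_unique _ _ Hl).
Qed.

Lemma filterlim_Gamma_boundary_0 (x : R) : 1 <= x ->
  filterlim (fun t => Rpower t x * exp (- t)) (at_right 0) (locally 0).
Proof.
intros Hx P [eps HP].
assert (Hm : 0 < Rmin 1 eps) by (apply Rmin_pos; [lra | apply cond_pos]).
exists (mkposreal _ Hm); intros t Ht Ht0; apply HP.
change (Rabs (t - 0) < Rmin 1 eps) in Ht.
change (Rabs (Rpower t x * exp (- t) - 0) < eps).
rewrite Rminus_0_r, Rabs_right in Ht by lra.
rewrite Rminus_0_r, Rabs_right by (left; apply Gamma_integrand_pos).
assert (t < 1) by (pose proof (Rmin_l 1 eps); lra).
assert (t < eps) by (pose proof (Rmin_r 1 eps); lra).
assert (Rpower t x <= t).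
{ rewrite <- (Rpower_1 t) at 2 by exact Ht0; unfold Rpower.
  assert (ln t < 0) by (rewrite <- ln_1; apply ln_increasing; lra).
  assert (Hle : x * ln t <= 1 * ln t) by nra.
  destruct Hle as [Hlt | ->]; [left; now apply exp_increasing | right; reflexivity]. }
assert (exp (- t) <= 1) by (rewrite <- exp_0; left; apply exp_increasing; lra).
assert (0 < Rpower t x) by apply exp_pos.
pose proof (exp_pos (- t)); nra.
Qed.

Lemma filterlim_Gamma_boundary_pinfty (x : R) : 1 <= x ->
  filterlim (fun t => Rpower t x * exp (- t)) (Rbar_locally p_infty) (locally 0).
Proof.
intros Hx; destruct (Gamma_integrand_le x) as (C & HC & Hle); [lra|].
intros P [eps HP].
(* The threshold solves C exp (-t/2) = eps. *)
exists (Rmax 0 (- 2 * ln (eps / C))); intros t Ht; apply HP.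
assert (0 < t) by (pose proof (Rmax_l 0 (- 2 * ln (eps / C))); lra).
assert (- t / 2 < ln (eps / C)) by (pose proof (Rmax_r 0 (- 2 * ln (eps / C))); lra).
change (Rabs (Rpower t x * exp (- t) - 0) < eps).
rewrite Rminus_0_r, Rabs_right by (left; apply Gamma_integrand_pos).
apply Rle_lt_trans with (1 := Hle t H).
replace (pos eps) with (C * exp (ln (eps / C))).
- apply Rmult_lt_compat_l, exp_increasing; assumption.
- rewrite exp_ln; [field; lra|].
  apply Rdiv_lt_0_compat; [apply cond_pos | exact HC].
Qed.

(** Integration by parts: t^x e^(-t) has derivative x t^(x-1) e^(-t) - t^x e^(-t) and tends to 0 at
    both ends, so the two integrals balance. *)
Lemma Gamma_succ (x : R) : 1 <= x -> Gamma (x + 1) = x * Gamma x.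
Proof.
intros Hx; set (F := fun t => Rpower t x * exp (- t)).
set (dF := fun t => x * (Rpower t (x - 1) * exp (- t)) - Rpower t x * exp (- t)).
assert (HdF : forall t, 0 < t -> is_derive F t (dF t)).
{ intros t Ht; unfold F, dF.
  evar_last.
  - apply (is_derive_mult (K := R_AbsRing) (fun t => Rpower t x) (fun t => exp (- t))).
    + now apply is_derive_Rpower.
    + auto_derive; [exact I | reflexivity].
    + intros; apply Rmult_comm.
  - unfold plus, mult; simpl; ring. }
assert (HcF : forall t, 0 < t -> continuous dF t).
{ intros t Ht; apply (continuous_minus (V := R_NormedModule)
    (fun t => x * (Rpower t (x - 1) * exp (- t))) (fun t => Rpower t x * exp (- t))).
  - apply (continuous_scal_r (V := R_NormedModule) x), continuous_Gamma_integrand, Ht.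
  - apply continuous_Gamma_integrand, Ht. }
assert (H0 : is_RInt_gen (Derive F) (at_right 0) (Rbar_locally p_infty) (0 - 0)).
{ apply is_RInt_gen_Derive; try apply _.
  - apply filter_prod_right_pinfty with 1 1; [lra|].
    intros a b Ha Hb t [Ht _]; simpl in Ht; exists (dF t); apply HdF.
    rewrite Rmin_left in Ht by lra; lra.
  - apply filter_prod_right_pinfty with 1 1; [lra|].
    intros a b Ha Hb t [Ht _]; simpl in Ht.
    rewrite Rmin_left in Ht by lra.
    apply (continuous_ext_loc _ dF); [| apply HcF; lra].
    exists (mkposreal (t / 2) ltac:(lra)); intros u Hu.
    change (Rabs (u - t) < t / 2) in Hu; apply Rabs_def2 in Hu.
    symmetry; apply is_derive_unique, HdF; lra.
  - now apply filterlim_Gamma_boundary_0.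
  - now apply filterlim_Gamma_boundary_pinfty. }
pose proof (is_RInt_gen_Gamma_value x Hx) as H1.
pose proof (is_RInt_gen_Gamma_value (x + 1) ltac:(lra)) as H2.
replace (x + 1 - 1) with x in H2 by ring.
pose proof (is_RInt_gen_minus _ _ _ _ (is_RInt_gen_scal _ x _ H1) H2) as H3.
apply (is_RInt_gen_ext _ (Derive F)) in H3.
- apply (is_RInt_gen_unique (V := R_CompleteNormedModule)) in H0, H3.
  rewrite H0 in H3; change (0 - 0 = x * Gamma x - Gamma (x + 1)) in H3; lra.
- apply filter_prod_right_pinfty with 1 1; [lra|].
  intros a b Ha Hb t [Ht _]; simpl in Ht.
  rewrite Rmin_left in Ht by lra.
  symmetry; apply is_derive_unique, HdF; lra.
Qed.

(** * Power series expansions at 0 *)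

Lemma CV_radius_ge_of_bounded (a : nat -> R) (r M : R) :
  (forall k, Rabs (a k * r ^ k) <= M) -> Rbar_le r (CV_radius a).
Proof.
intros H; apply (proj1 (CV_radius_bounded a)); now exists M.
Qed.

Lemma CV_radius_ge_of_ex (a : nat -> R) (x : R) :
  ex_pseries a x -> Rbar_le (Rabs x) (CV_radius a).
Proof.
intros Hex; apply Rbar_not_lt_le; intros Hlt.
apply (CV_disk_outside _ _ Hlt).
apply (is_lim_seq_ext (fun k => scal (pow_n x k) (a k))).
- intros k; rewrite pow_n_pow; apply Rmult_comm.
- now apply ex_series_lim_0.
Qed.

Lemma locally_Rabs_lt (a : Rbar) : Rbar_lt 0 a ->
  locally 0 (fun x : R => Rbar_lt (Rabs x) a).
Proof.
intros Ha.
assert (Hd : exists d : posreal, Rbar_le d a).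
{ destruct a as [r| |]; simpl in Ha; try contradiction.
  - exists (mkposreal r Ha); simpl; lra.
  - now exists (mkposreal 1 Rlt_0_1). }
destruct Hd as [d Hd]; exists d; intros x Hx.
change (Rabs (x - 0) < d) in Hx; rewrite Rminus_0_r in Hx.
now apply Rbar_lt_le_trans with (2 := Hd).
Qed.

Lemma locally_ex_pos (P : R -> Prop) : locally 0 P -> exists x, 0 < x /\ P x.
Proof.
intros [d Hd]; exists (d / 2); pose proof (cond_pos d); split; [lra|].
apply Hd; change (Rabs (d / 2 - 0) < d); rewrite Rminus_0_r, Rabs_right; lra.
Qed.

(** Analytic germs: sums and products combine without bookkeeping of radii. Positivity is a separate
    clause because [PSeries] has a value even where the series diverges. *)
Definition pseries_at0 (f : R -> R) (a : nat -> R) : Prop :=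
  Rbar_lt 0 (CV_radius a) /\ locally 0 (fun x => f x = PSeries a x).

(** Convergence at a single positive point already makes the radius positive. *)
Lemma pseries_at0_of_locally (f : R -> R) (a : nat -> R) :
  locally 0 (fun x => is_pseries a x (f x)) -> pseries_at0 f a.
Proof.
intros H; split.
- destruct (locally_ex_pos _ H) as (x & Hx & Hs).
  apply Rbar_lt_le_trans with (Rabs x).
  + rewrite Rabs_right; simpl; lra.
  + apply CV_radius_ge_of_ex; eexists; exact Hs.
- revert H; apply filter_imp; intros x Hx; symmetry; now apply is_pseries_unique.
Qed.

Lemma pseries_at0_locally (f : R -> R) (a : nat -> R) :
  pseries_at0 f a ->
  locally 0 (fun x => Rbar_lt (Rabs x) (CV_radius a) /\ is_pseries a x (f x)).
Proof.
intros [Ha Hf]; apply locally_Rabs_lt in Ha.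
generalize (filter_and _ _ Ha Hf); apply filter_imp; intros x [H1 ->].
split; [exact H1|]; now apply PSeries_correct, CV_radius_inside.
Qed.

Lemma pseries_at0_PSeries (a : nat -> R) :
  Rbar_lt 0 (CV_radius a) -> pseries_at0 (PSeries a) a.
Proof. intros Ha; split; [exact Ha|]; now apply filter_forall. Qed.

Lemma pseries_at0_minus (f g : R -> R) (a b : nat -> R) :
  pseries_at0 f a -> pseries_at0 g b ->
  pseries_at0 (fun x => f x - g x) (fun k => a k - b k).
Proof.
intros Hf%pseries_at0_locally Hg%pseries_at0_locally.
apply pseries_at0_of_locally.
generalize (filter_and _ _ Hf Hg); apply filter_imp; intros x [[_ H1] [_ H2]].
exact (is_pseries_minus _ _ _ _ _ H1 H2).
Qed.

Lemma pseries_at0_plus (f g : R -> R) (a b : nat -> R) :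
  pseries_at0 f a -> pseries_at0 g b ->
  pseries_at0 (fun x => f x + g x) (fun k => a k + b k).
Proof.
intros Hf%pseries_at0_locally Hg%pseries_at0_locally.
apply pseries_at0_of_locally.
generalize (filter_and _ _ Hf Hg); apply filter_imp; intros x [[_ H1] [_ H2]].
exact (is_pseries_plus _ _ _ _ _ H1 H2).
Qed.

Lemma pseries_at0_scal (c : R) (f : R -> R) (a : nat -> R) :
  pseries_at0 f a -> pseries_at0 (fun x => c * f x) (fun k => c * a k).
Proof.
intros Hf%pseries_at0_locally; apply pseries_at0_of_locally.
revert Hf; apply filter_imp; intros x [_ H1].
exact (is_pseries_scal c _ _ _ (Rmult_comm _ _) H1).
Qed.

Lemma pseries_at0_mult (f g : R -> R) (a b : nat -> R) :
  pseries_at0 f a -> pseries_at0 g b ->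
  pseries_at0 (fun x => f x * g x) (PS_mult a b).
Proof.
intros Hf%pseries_at0_locally Hg%pseries_at0_locally.
apply pseries_at0_of_locally.
generalize (filter_and _ _ Hf Hg); apply filter_imp; intros x [[] []].
now apply is_pseries_mult.
Qed.

Lemma pseries_at0_incr_n (f : R -> R) (a : nat -> R) (m : nat) :
  pseries_at0 f a -> pseries_at0 (fun x => x ^ m * f x) (PS_incr_n a m).
Proof.
intros Hf%pseries_at0_locally; apply pseries_at0_of_locally.
revert Hf; apply filter_imp; intros x [_ H1].
rewrite <- pow_n_pow; exact (is_pseries_incr_n _ m _ _ H1).
Qed.

Lemma pseries_at0_ext (f g : R -> R) (a b : nat -> R) :
  locally 0 (fun x => g x = f x) -> (forall k, a k = b k) ->
  pseries_at0 f a -> pseries_at0 g b.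
Proof.
intros Hfg Hab [Ha Hf]; split.
- now rewrite <- (CV_radius_ext a b Hab).
- generalize (filter_and _ _ Hfg Hf); apply filter_imp; intros x [-> ->].
  now apply PSeries_ext.
Qed.

Definition PS_one (k : nat) : R := if k then 1 else 0.

Fixpoint PS_pow (a : nat -> R) (j : nat) : nat -> R :=
  match j with O => PS_one | S j' => PS_mult a (PS_pow a j') end.

Lemma is_pseries_const (a : nat -> R) (x : R) :
  (forall k, a (S k) = 0) -> is_pseries a x (a 0%nat).
Proof.
intros Ha; apply (is_lim_seq_ext (fun _ => a 0%nat) _ (a 0%nat));
  [|apply is_lim_seq_const].
induction n as [|n IH].
- rewrite sum_O; symmetry; apply (scal_one (a 0%nat)).
- rewrite sum_Sn, <- IH, Ha; symmetry.
  unfold plus, scal; simpl; unfold mult; simpl; ring.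
Qed.

Lemma pseries_at0_1 : pseries_at0 (fun _ => 1) PS_one.
Proof.
apply pseries_at0_of_locally, filter_forall.
intros x; now apply (is_pseries_const PS_one).
Qed.

Lemma pseries_at0_pow (f : R -> R) (a : nat -> R) (j : nat) :
  pseries_at0 f a -> pseries_at0 (fun x => f x ^ j) (PS_pow a j).
Proof.
intros Hf; induction j as [|j IH]; simpl.
- exact pseries_at0_1.
- now apply pseries_at0_mult.
Qed.

Lemma PS_pow_0 (a : nat -> R) (j : nat) : PS_pow a j 0 = a 0%nat ^ j.
Proof.
induction j as [|j IH]; [reflexivity|].
simpl; unfold PS_mult; simpl; now rewrite IH.
Qed.

Lemma pseries_at0_sum (f : nat -> R -> R) (a : nat -> nat -> R) (N : nat) :
  (forall j, pseries_at0 (f j) (a j)) ->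
  pseries_at0 (fun x => sum_f_R0 (fun j => f j x) N)
    (fun k => sum_f_R0 (fun j => a j k) N).
Proof.
intros H; induction N as [|N IH]; [apply H|].
now apply pseries_at0_plus.
Qed.

(** Induction on N: the bound tends to 0 with x, which kills the constant term; dividing by x lowers
    N. Positive x suffice, as the contradiction arises at one small positive point. *)
Lemma pseries_at0_order (N : nat) (f : R -> R) (a : nat -> R) (M : R) :
  pseries_at0 f a -> locally 0 (fun x => 0 < x -> Rabs (f x) <= M * x ^ N) ->
  forall k, (k < N)%nat -> a k = 0.
Proof.
revert f a; induction N as [|N IH]; intros f a Hf HM k Hk; [lia|].
assert (Ha0 : a 0%nat = 0).
{ apply Rminus_diag_uniq, Classical_Prop.NNPP; intros Hne.
  rewrite Rminus_0_r in Hne; apply Rabs_pos_lt in Hne.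
  assert (Hc : locally 0 (fun x => Rabs (PSeries a x - PSeries a 0) < Rabs (a 0%nat) / 2)).
  { assert (HC : continuous (PSeries a) 0).
    { apply continuity_pt_filterlim, PSeries_continuity.
      rewrite Rabs_R0; apply Hf. }
    apply (HC (fun y => Rabs (y - PSeries a 0) < Rabs (a 0%nat) / 2)).
    exists (mkposreal (Rabs (a 0%nat) / 2) ltac:(lra)); intros y Hy; exact Hy. }
  (* Chosen so that (|M| + 1) x < |a_0| / 2, against |f x| > |a_0| / 2 from continuity; the + 1
     keeps the denominator nonzero. *)
  assert (Hs : locally 0 (fun x : R => Rabs x < Rmin 1 (Rabs (a 0%nat) / (2 * (Rabs M + 1))))).
  { apply (locally_Rabs_lt (Finite _)); simpl; apply Rmin_pos; [lra|].
    apply Rdiv_lt_0_compat; [exact Hne|]; pose proof (Rabs_pos M); lra. }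
  destruct (locally_ex_pos _ (filter_and _ _ (filter_and _ _ Hc Hs)
    (filter_and _ _ (proj2 Hf) HM))) as (x & Hx & [[H1 H2] [H3 H4]]).
  specialize (H4 Hx); rewrite H3 in H4; rewrite PSeries_0 in H1.
  rewrite Rabs_right in H2 by lra.
  assert (Hx1 : x < 1) by (pose proof (Rmin_l 1 (Rabs (a 0%nat) / (2 * (Rabs M + 1)))); lra).
  assert (Hx2 : x < Rabs (a 0%nat) / (2 * (Rabs M + 1)))
    by (pose proof (Rmin_r 1 (Rabs (a 0%nat) / (2 * (Rabs M + 1)))); lra).
  pose proof (Rabs_pos M) as HMp.
  assert (Hx3 : (Rabs M + 1) * x < Rabs (a 0%nat) / 2).
  { apply (Rmult_lt_compat_l (Rabs M + 1)) in Hx2; [|lra].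
    replace ((Rabs M + 1) * (Rabs (a 0%nat) / (2 * (Rabs M + 1))))
      with (Rabs (a 0%nat) / 2) in Hx2 by (field; lra).
    exact Hx2. }
  assert (HxN : 0 <= x ^ N <= 1).
  { split; [apply pow_le; lra|]; rewrite <- (pow1 N); apply pow_incr; lra. }
  assert (H5 : M * x ^ S N <= Rabs M * x).
  { simpl; pose proof (Rle_abs M) as HMa.
    apply Rle_trans with (Rabs M * (x * x ^ N)).
    - apply Rmult_le_compat_r; [nra | exact HMa].
    - apply Rmult_le_compat_l; nra. }
  pose proof (Rabs_triang_inv (a 0%nat) (a 0%nat - PSeries a x)) as H6.
  rewrite (Rabs_minus_sym (a 0%nat)) in H6.
  replace (a 0%nat - (a 0%nat - PSeries a x)) with (PSeries a x) in H6 by ring.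
  lra. }
destruct k as [|k]; [exact Ha0|].
apply (IH (PSeries (PS_decr_1 a)) (PS_decr_1 a)); [| |lia].
- apply pseries_at0_PSeries; rewrite CV_radius_decr_1; apply Hf.
- generalize (filter_and _ _ (pseries_at0_locally _ _ Hf) HM).
  apply filter_imp; intros x [[H1 H2] H3] Hx.
  specialize (H3 Hx); rewrite <- (is_pseries_unique _ _ _ H2) in H3.
  rewrite PSeries_decr_1, Ha0, Rplus_0_l, Rabs_mult, (Rabs_right x) in H3
    by first [lra | now apply CV_radius_inside].
  apply (Rmult_le_reg_l x); [exact Hx|]; simpl in H3; lra.
Qed.

(** As a series in x, f has the a_k at the even places and 0 at the odd ones; its derivatives at 0
    are then read off termwise. *)
Lemma coef0_even (f : R -> R) (a : nat -> R) (k : nat) :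
  Rbar_lt 0 (CV_radius a) -> locally 0 (fun x => f x = PSeries a (x ^ 2)) ->
  coef0 f (2 * k) = a k.
Proof.
intros Ha Hf; set (e := fun i => if Nat.even i then a (Nat.div2 i) else 0).
assert (He : pseries_at0 f e).
{ apply pseries_at0_of_locally.
  assert (H2 : locally 0 (fun x : R => Rbar_lt (Rabs (x ^ 2)) (CV_radius a))).
  { generalize (filter_and _ _ (locally_Rabs_lt _ Ha) (locally_Rabs_lt 1 Rlt_0_1)).
    apply filter_imp; intros x [H1 H2]; simpl in H2.
    apply Rbar_le_lt_trans with (2 := H1); simpl.
    rewrite Rmult_1_r, Rabs_mult; pose proof (Rabs_pos x); nra. }
  generalize (filter_and _ _ Hf H2); apply filter_imp; intros x [-> Hx].
  replace (PSeries a (x ^ 2)) with (PSeries a (x ^ 2) + x * 0) by ring.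
  apply is_pseries_odd_even.
  - apply is_pseries_ext with a.
    + intros i; unfold e; now rewrite Nat.even_even, Nat.div2_double.
    + now apply PSeries_correct, CV_radius_inside.
  - apply is_pseries_ext with (fun _ => 0).
    + intros i; unfold e; now rewrite Nat.even_odd.
    + now apply (is_pseries_const (fun _ => 0)). }
unfold coef0; rewrite (Derive_n_ext_loc f (PSeries e)) by apply He.
rewrite Derive_n_coef by apply He; unfold e; rewrite Nat.even_even, Nat.div2_double.
field; apply INR_fact_neq_0.
Qed.

(** * The Bessel quotient near 0 *)

(** x f f' = -g f^2 <= 0 gives (f^2)' <= 0 for x > 0, so the mean value theorem bounds f(x)^2 by
    f(0)^2 = 0. *)
Lemma singular_ode_zero (f f' g : R -> R) (d : R) :
  f 0 = 0 ->
  (forall x, 0 <= x < d -> is_derive f x (f' x)) ->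
  (forall x, 0 < x < d -> 0 <= g x /\ x * f' x = - g x * f x) ->
  forall x, 0 <= x < d -> f x = 0.
Proof.
intros Hf0 Hd Hg x [Hx0 Hxd].
destruct Hx0 as [Hx0 | <-]; [|exact Hf0].
destruct (MVT_cor2 (fun t => f t * f t) (fun t => 2 * (f t * f' t)) 0 x Hx0)
  as (t & Ht & Ht1).
- intros t Ht; apply is_derive_Reals; evar_last.
  + apply (is_derive_mult (K := R_AbsRing) f f); [apply Hd; lra | apply Hd; lra |].
    intros; apply Rmult_comm.
  + unfold plus, mult; simpl; ring.
- cbv beta in Ht; rewrite Hf0 in Ht.
  destruct (Hg t) as [Hgt Het]; [lra|].
  assert (f t * f' t <= 0).
  { apply (Rmult_le_reg_l t); [lra|].
    replace (t * (f t * f' t)) with (f t * (t * f' t)) by ring.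
    rewrite Het; pose proof (Rle_0_sqr (f t)) as Hs; unfold Rsqr in Hs; nra. }
  nra.
Qed.

Lemma continuous_PSeries_0 (a : nat -> R) :
  Rbar_lt 0 (CV_radius a) -> continuous (PSeries a) 0.
Proof.
intros Ha; apply continuity_pt_filterlim, PSeries_continuity; now rewrite Rabs_R0.
Qed.

Lemma locally_gt_of_continuous (f : R -> R) (c : R) :
  continuous f 0 -> c < f 0 -> locally 0 (fun x => c < f x).
Proof. intros Hf Hc; apply (Hf (fun y => c < y)); now apply open_gt. Qed.

Lemma locally_sqr (Q : R -> Prop) : locally 0 Q -> locally 0 (fun x => Q (x ^ 2)).
Proof.
intros HQ; assert (Hc : continuous (fun x : R => x ^ 2) 0)
  by (apply (ex_derive_continuous (fun x : R => x ^ 2)); auto_derive; exact I).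
apply Hc; now replace (0 ^ 2) with 0 by ring.
Qed.

(** Coefficients of P, where I_{n/2-1}(x) = (x/2)^(n/2-1) P(x^2). *)
Definition bessel_coef (n m : nat) : R :=
  / (4 ^ m * INR (fact m) * Gamma (INR n / 2 + INR m)).

Lemma Rpower_half_even (x : R) (nu : R) (m : nat) : 0 < x ->
  Rpower (x / 2) (nu + 2 * INR m) = Rpower (x / 2) nu * ((x ^ 2) ^ m / 4 ^ m).
Proof.
intros Hx; rewrite Rpower_plus; f_equal.
replace (2 * INR m) with (INR (2 * m)) by (rewrite mult_INR; simpl; ring).
rewrite Rpower_pow, pow_mult by lra.
replace ((x / 2) ^ 2) with (x ^ 2 * / 4) by field.
now rewrite Rpow_mult_distr, pow_inv.
Qed.

Lemma BesselI_pred_half (n : nat) (x : R) : 0 < x ->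
  BesselI (INR n / 2 - 1) x
  = Rpower (x / 2) (INR n / 2 - 1) * PSeries (bessel_coef n) (x ^ 2).
Proof.
intros Hx; unfold BesselI, PSeries; rewrite <- Series_scal_l.
apply Series_ext; intros m; rewrite Rpower_half_even by exact Hx.
unfold bessel_coef.
replace (INR n / 2 - 1 + INR m + 1) with (INR n / 2 + INR m) by ring.
unfold Rdiv; rewrite !Rinv_mult; ring.
Qed.

(** Shifting m to m + 1 in P yields Gamma(n/2 + m + 1), and the factor m + 1 of the derivative
    reduces (m+1)! to m!. The 4 compensates for 4^(m+1). *)
Lemma BesselI_half (n : nat) (x : R) : 0 < x ->
  BesselI (INR n / 2) x
  = Rpower (x / 2) (INR n / 2) * (4 * PSeries (PS_derive (bessel_coef n)) (x ^ 2)).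
Proof.
intros Hx; unfold BesselI, PSeries; rewrite <- !Series_scal_l.
apply Series_ext; intros m; rewrite Rpower_half_even by exact Hx.
unfold PS_derive, bessel_coef.
replace (INR n / 2 + INR m + 1) with (INR n / 2 + INR (S m)) by (rewrite S_INR; ring).
rewrite fact_simpl, mult_INR; change (4 ^ S m) with (4 * 4 ^ m).
pose proof (INR_fact_neq_0 m) as H1; pose proof (not_0_INR (S m) (Nat.neq_succ_0 m)) as H2.
unfold Rdiv; rewrite !Rinv_mult.
set (G := / Gamma _); field; repeat split; try assumption; apply pow_nonzero; lra.
Qed.

Lemma BesselA_eq (n : nat) (x : R) :
  BesselA n x = 2 * x * (PSeries (PS_derive (bessel_coef n)) (x ^ 2)
                         / PSeries (bessel_coef n) (x ^ 2)).
Proof.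
assert (Hpos : forall t, 0 < t ->
  BesselI (INR n / 2) t / BesselI (INR n / 2 - 1) t
  = 2 * t * (PSeries (PS_derive (bessel_coef n)) (t ^ 2)
                         / PSeries (bessel_coef n) (t ^ 2))).
{ intros t Ht; rewrite BesselI_half, BesselI_pred_half by exact Ht.
  replace (INR n / 2) with (INR n / 2 - 1 + 1) at 1 by ring.
  rewrite Rpower_plus, Rpower_1 by lra; unfold Rdiv; rewrite Rinv_mult.
  assert (0 < Rpower (t * / 2) (INR n * / 2 - 1)) by apply exp_pos.
  (* The inverse of P occurs on both sides; kept opaque, it does not make [field] ask for P to be
     nonzero. *)
  set (p := Rpower _ _) in *; set (q := / PSeries _ _); field; lra. }
unfold BesselA; destruct (Rtotal_order x 0) as [Hx | [-> | Hx]].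
- rewrite sign_eq_m1, Rabs_left, Hpos by lra.
  replace ((- x) ^ 2) with (x ^ 2) by ring; unfold Rdiv; ring.
- rewrite sign_0; ring.
- rewrite sign_eq_1, Rabs_right, Hpos by lra; ring.
Qed.

(** Here n >= 2 enters: it puts the arguments of [Gamma] in [bessel_coef] into [1, infinity). *)
Lemma INR_half_ge1 (n m : nat) : (2 <= n)%nat -> 1 <= INR n / 2 + INR m.
Proof.
intros Hn; apply le_INR in Hn; simpl in Hn; pose proof (pos_INR m); lra.
Qed.

Lemma bessel_coef_pos (n m : nat) : (2 <= n)%nat -> 0 < bessel_coef n m.
Proof.
intros Hn; apply Rinv_0_lt_compat.
repeat apply Rmult_lt_0_compat; [apply pow_lt; lra | apply INR_fact_lt_0 |].
now apply Gamma_pos, INR_half_ge1.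
Qed.

(** Coefficient form of z P'' + (n/2) P' = P/4; the functional equation of Gamma supplies the factor
    m + n/2. *)
Lemma bessel_coef_rec (n m : nat) : (2 <= n)%nat ->
  INR (S m) * (INR m + INR n / 2) * bessel_coef n (S m) = bessel_coef n m / 4.
Proof.
intros Hn; pose proof (INR_half_ge1 n m Hn) as H1.
unfold bessel_coef; replace (INR n / 2 + INR (S m)) with (INR n / 2 + INR m + 1)
  by (rewrite S_INR; ring).
rewrite Gamma_succ, fact_simpl, mult_INR by exact H1; change (4 ^ S m) with (4 * 4 ^ m).
pose proof (INR_fact_neq_0 m); pose proof (not_0_INR (S m) (Nat.neq_succ_0 m)).
pose proof (Gamma_pos _ H1).
field; repeat split; try lra; try assumption; apply pow_nonzero; lra.
Qed.

(** Since (k + 1)(k + n/2) >= 1, the coefficients decrease, hence are bounded; radius 1 is enough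
    for local statements. *)
Lemma CV_radius_bessel_coef (n : nat) : (2 <= n)%nat ->
  Rbar_le 1 (CV_radius (bessel_coef n)).
Proof.
intros Hn; apply CV_radius_ge_of_bounded with (bessel_coef n 0).
intros k; rewrite pow1, Rmult_1_r, Rabs_right by (left; now apply bessel_coef_pos).
induction k as [|k IH]; [apply Rle_refl|].
apply Rle_trans with (2 := IH).
pose proof (bessel_coef_rec n k Hn) as H; pose proof (bessel_coef_pos n (S k) Hn).
pose proof (INR_half_ge1 n k Hn); pose proof (bessel_coef_pos n k Hn).
rewrite S_INR in H; pose proof (pos_INR k).
assert (1 * bessel_coef n (S k)
        <= ((INR k + 1) * (INR k + INR n / 2)) * bessel_coef n (S k)).
{ apply Rmult_le_compat_r; nra. }
lra.
Qed.

Lemma Rbar_lt_CV_radius (a : nat -> R) (x : R) :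
  Rbar_le 1 (CV_radius a) -> Rabs x < 1 -> Rbar_lt (Rabs x) (CV_radius a).
Proof. intros Ha Hx; now apply Rbar_lt_le_trans with (2 := Ha). Qed.

Lemma PSeries_bessel_coef_ode (n : nat) (x : R) : (2 <= n)%nat -> Rabs x < 1 ->
  x * PSeries (PS_derive (PS_derive (bessel_coef n))) x
  + INR n / 2 * PSeries (PS_derive (bessel_coef n)) x = PSeries (bessel_coef n) x / 4.
Proof.
intros Hn Hx.
assert (Hr := Rbar_lt_CV_radius _ _ (CV_radius_bessel_coef n Hn) Hx).
assert (Hr1 : ex_pseries (PS_derive (bessel_coef n)) x)
  by (apply CV_radius_inside; now rewrite CV_radius_derive).
assert (Hr2 : ex_pseries (PS_derive (PS_derive (bessel_coef n))) x)
  by (apply CV_radius_inside; now rewrite !CV_radius_derive).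
rewrite <- PSeries_incr_1, <- PSeries_scal, <- PSeries_plus.
- replace (PSeries (bessel_coef n) x / 4) with (/ 4 * PSeries (bessel_coef n) x) by field.
  rewrite <- PSeries_scal; apply PSeries_ext; intros m.
  unfold PS_plus, PS_scal, PS_incr_1, plus, scal; simpl; unfold mult; simpl.
  replace (/ 4 * bessel_coef n m) with (bessel_coef n m / 4) by field.
  rewrite <- bessel_coef_rec by exact Hn.
  destruct m as [|m]; unfold PS_derive; rewrite ?S_INR; [change zero with 0; simpl|]; ring.
- now apply ex_pseries_incr_1.
- apply ex_pseries_scal; [apply Rmult_comm | exact Hr1].
Qed.

(** The divisor n + 2 (j + 1) outweighs the j + 1 products of modulus at most 1 in the
    convolution. *)
Lemma a_bounded (n j : nat) : (1 <= n)%nat -> Rabs (a_ n j) <= 1.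
Proof.
intros Hn; apply le_INR in Hn; simpl in Hn.
induction j as [[|j] IH] using (well_founded_induction Wf_nat.lt_wf).
- rewrite a_0, Rabs_right.
  + apply (Rmult_le_reg_r (INR n)); [lra|]; field_simplify; lra.
  + apply Rle_ge, Rlt_le, Rdiv_lt_0_compat; lra.
- rewrite a_rec by lia; replace (S j - 1)%nat with j by lia.
  rewrite sum_n_Reals, Rabs_mult.
  assert (Hs : Rabs (sum_f_R0 (fun k => a_ n k * a_ n (j - k)%nat) j) <= INR (S j)).
  { apply Rle_trans with (1 := Rsum_abs _ _).
    apply Rle_trans with (sum_f_R0 (fun _ => 1) j).
    - apply sum_Rle; intros k Hk; rewrite Rabs_mult, <- (Rmult_1_l 1).
      apply Rmult_le_compat; try apply Rabs_pos; apply IH; lia.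
    - rewrite sum_cte; lra. }
  pose proof (pos_INR (S j)) as HSj.
  set (d := INR n + 2 * INR (S j)); assert (Hd : 0 < d) by (unfold d; lra).
  assert (Rabs (-1 / d) = / d) as ->.
  { unfold Rdiv; rewrite Rabs_mult, Rabs_left, Rabs_right by
      first [lra | apply Rle_ge, Rlt_le, Rinv_0_lt_compat, Hd]; ring. }
  apply (Rmult_le_reg_l d); [exact Hd|].
  rewrite <- Rmult_assoc, Rinv_r, Rmult_1_l by lra; unfold d; lra.
Qed.

Lemma CV_radius_a (n : nat) : (1 <= n)%nat -> Rbar_le 1 (CV_radius (a_ n)).
Proof.
intros Hn; apply CV_radius_ge_of_bounded with 1; intros k.
rewrite pow1, Rmult_1_r; now apply a_bounded.
Qed.

Lemma radius_A_ge1 (n : nat) : (1 <= n)%nat -> Rbar_le 1 (radius_A n).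
Proof.
intros Hn; apply CV_radius_ge_of_bounded with 1; intros k.
rewrite pow1, Rmult_1_r; destruct (Nat.odd k); [now apply a_bounded|].
rewrite Rabs_R0; lra.
Qed.

(* The recursion of the [a_j] is the Riccati equation
   A' = 1 - A^2 - (n - 1) A / kappa for A = kappa h(kappa^2). *)
Lemma PSeries_a_riccati (n : nat) (x : R) : (1 <= n)%nat -> Rabs x < 1 ->
  INR n * PSeries (a_ n) x + 2 * (x * PSeries (PS_derive (a_ n)) x)
  + x * (PSeries (a_ n) x * PSeries (a_ n) x) = 1.
Proof.
intros Hn Hx.
assert (Hr := Rbar_lt_CV_radius _ _ (CV_radius_a n Hn) Hx).
assert (Hs1 : ex_pseries (PS_scal (INR n) (a_ n)) x).
{ apply ex_pseries_scal; [apply Rmult_comm | now apply CV_radius_inside]. }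
assert (Hs2 : ex_pseries (PS_scal 2 (PS_incr_1 (PS_derive (a_ n)))) x).
{ apply ex_pseries_scal; [apply Rmult_comm|].
  apply ex_pseries_incr_1, CV_radius_inside; now rewrite CV_radius_derive. }
rewrite <- PSeries_mult by exact Hr.
rewrite <- !PSeries_incr_1, <- !PSeries_scal, <- !PSeries_plus.
(* The recursion of the a_j says that every coefficient of e after the constant one vanishes. *)
- set (e := PS_plus _ _); assert (He0 : e 0%nat = 1).
  { unfold e, PS_plus, PS_scal, plus, scal; simpl; unfold mult; simpl.
    change zero with 0; rewrite a_0; field; apply not_0_INR; lia. }
  rewrite <- He0; apply is_pseries_unique, is_pseries_const; intros k.
  unfold e, PS_plus, PS_scal, PS_incr_1, PS_derive, plus, scal; simpl PS_mult.
  unfold PS_mult; cbn [plus scal]; rewrite (a_rec n (S k)) by lia.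
  replace (S k - 1)%nat with k by lia; rewrite sum_n_Reals.
  set (s := sum_f_R0 _ _); simpl AbelianMonoid.plus.
  pose proof (pos_INR (S k)); apply le_INR in Hn; simpl (INR 1) in Hn.
  unfold plus, mult; cbn -[INR]; change (match k with O => 1 | S _ => INR k + 1 end) with (INR (S k)).
  field; lra.
- now apply ex_pseries_plus.
- now apply ex_pseries_incr_1, ex_pseries_mult.
- exact Hs1.
- exact Hs2.
Qed.

Lemma locally_0_Rabs (Q : R -> Prop) : locally 0 Q ->
  exists d : posreal, forall x, Rabs x < d -> Q x.
Proof.
intros [d Hd]; exists d; intros x Hx; apply Hd.
change (Rabs (x - 0) < d); now rewrite Rminus_0_r.
Qed.

(* For h the series of the [a_j] and P that of [bessel_coef], y = h P - 2 P' solves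
   2 z y' = -(n + z h) y. *)
Lemma PSeries_a_bessel (n : nat) : (2 <= n)%nat ->
  locally 0 (fun z => 0 <= z ->
    PSeries (a_ n) z * PSeries (bessel_coef n) z
    = 2 * PSeries (PS_derive (bessel_coef n)) z).
Proof.
intros Hn; assert (Hn1 : (1 <= n)%nat) by lia.
pose proof (CV_radius_a n Hn1) as Ra; pose proof (CV_radius_bessel_coef n Hn) as Rp.
set (h := PSeries (a_ n)); set (h' := PSeries (PS_derive (a_ n))).
set (p := PSeries (bessel_coef n)); set (p' := PSeries (PS_derive (bessel_coef n))).
set (p'' := PSeries (PS_derive (PS_derive (bessel_coef n)))).
assert (Hh : forall z, Rabs z < 1 -> is_derive h z (h' z)).
{ intros z Hz; apply is_derive_PSeries; now apply Rbar_lt_CV_radius. }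
assert (Hp : forall z, Rabs z < 1 -> is_derive p z (p' z)).
{ intros z Hz; apply is_derive_PSeries; now apply Rbar_lt_CV_radius. }
assert (Hp' : forall z, Rabs z < 1 -> is_derive p' z (p'' z)).
{ intros z Hz; apply is_derive_PSeries; rewrite CV_radius_derive.
  now apply Rbar_lt_CV_radius. }
(* This fixes the sign that [singular_ode_zero] requires. *)
assert (Hc : locally 0 (fun z => 0 < INR n + z * h z)).
{ apply (locally_gt_of_continuous (fun z => INR n + z * h z)).
  - apply (ex_derive_continuous (fun z => INR n + z * h z)).
    eexists; apply (is_derive_plus (V := R_NormedModule)).
    + apply is_derive_const.
    + apply (is_derive_mult (K := R_AbsRing) (fun z => z) h).
      * apply is_derive_id.
      * apply Hh; rewrite Rabs_R0; lra.
      * intros; apply Rmult_comm.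
  - rewrite Rmult_0_l, Rplus_0_r; apply lt_0_INR; lia. }
destruct (locally_0_Rabs _ (filter_and _ _ Hc (locally_Rabs_lt 1 Rlt_0_1))) as [d Hd].
exists d; intros z Hz Hz0.
change (Rabs (z - 0) < d) in Hz; rewrite Rminus_0_r, Rabs_right in Hz by lra.
apply Rminus_diag_uniq.
apply (singular_ode_zero (fun z => h z * p z - 2 * p' z)
  (fun z => h' z * p z + h z * p' z - 2 * p'' z)
  (fun z => (INR n + z * h z) / 2) d); [| | |lra].
(* The initial value vanishes by [bessel_coef_rec] at m = 0, which reads p_0 = 2 n p_1. *)
- unfold h, p, p'; rewrite !PSeries_0, a_0; unfold PS_derive.
  pose proof (bessel_coef_rec n 0 Hn) as H; simpl in H.
  assert (INR n <> 0) by (apply not_0_INR; lia).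
  replace (bessel_coef n 0) with (2 * INR n * bessel_coef n 1) by lra.
  simpl INR; field; assumption.
- intros x Hx; destruct (Hd x) as [_ Hx1]; [rewrite Rabs_right; lra|]; simpl in Hx1.
  evar_last.
  + apply (is_derive_minus (V := R_NormedModule) (fun z => h z * p z) (fun z => 2 * p' z)).
    * apply (is_derive_mult (K := R_AbsRing) h p); [now apply Hh | now apply Hp |].
      intros; apply Rmult_comm.
    * now apply is_derive_scal, Hp'.
  + unfold minus, plus, opp, mult; simpl; ring.
- intros x Hx; destruct (Hd x) as [Hx0 Hx1]; [rewrite Rabs_right; lra|]; simpl in Hx1.
  split; [lra|].
  pose proof (PSeries_a_riccati n x Hn1 Hx1) as H1; fold h h' in H1.
  pose proof (PSeries_bessel_coef_ode n x Hn Hx1) as H2; fold p p' p'' in H2.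
  assert (H3 : 2 * (x * h' x) = 1 - INR n * h x - x * (h x * h x)) by lra.
  assert (H4 : x * p'' x = p x / 4 - INR n / 2 * p' x) by lra.
  replace (x * (h' x * p x + h x * p' x - 2 * p'' x))
    with (/ 2 * (2 * (x * h' x)) * p x + x * h x * p' x - 2 * (x * p'' x)) by field.
  rewrite H3, H4; field.
Qed.

Lemma BesselA_pseries (n : nat) : (2 <= n)%nat ->
  locally 0 (fun x => BesselA n x = x * PSeries (a_ n) (x ^ 2)).
Proof.
intros Hn.
assert (Hp : locally 0 (fun z => 0 < PSeries (bessel_coef n) z)).
{ apply locally_gt_of_continuous.
  - apply continuous_PSeries_0, Rbar_lt_le_trans with (2 := CV_radius_bessel_coef n Hn).
    exact Rlt_0_1.
  - rewrite PSeries_0; now apply bessel_coef_pos. }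
generalize (locally_sqr _ (filter_and _ _ Hp (PSeries_a_bessel n Hn))).
apply filter_imp; intros x [H1 H2]; specialize (H2 (pow2_ge_0 x)).
rewrite BesselA_eq.
replace (PSeries (a_ n) (x ^ 2)) with
  (2 * PSeries (PS_derive (bessel_coef n)) (x ^ 2) / PSeries (bessel_coef n) (x ^ 2)).
- field; lra.
- rewrite <- H2; field; lra.
Qed.

(** * The inverse series *)

(** Iteration from the zero sequence: if [Phi i] looks only below i, the value at i is final after i
    + 1 rounds. *)
Fixpoint iterate_rec (Phi : nat -> (nat -> R) -> R) (j : nat) : nat -> R :=
  match j with
  | O => fun _ => 0
  | S j' => fun i => Phi i (iterate_rec Phi j')
  end.

Lemma course_of_values_rec (Phi : nat -> (nat -> R) -> R) :
  (forall m f g, (forall i, (i < m)%nat -> f i = g i) -> Phi m f = Phi m g) ->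
  exists u, forall m, u m = Phi m u.
Proof.
intros HPhi.
assert (Hst : forall j k i, (i < j)%nat -> (i < k)%nat ->
          iterate_rec Phi j i = iterate_rec Phi k i).
{ induction j as [|j IH]; intros [|k] i Hj Hk; try lia.
  apply HPhi; intros i' Hi'; apply IH; lia. }
exists (fun m => iterate_rec Phi (S m) m); intros m.
apply HPhi; intros i Hi; apply Hst; lia.
Qed.

(* Coefficient form of (u + 2 w u') (u (1 - w) - (n - 1)) = u, the equation that the
   Riccati equation for A imposes on its inverse A |-> A u(A^2). *)
Definition inverse_coef (n : nat) (u : nat -> R) : Prop :=
  u 0%nat = INR n /\ (INR n + 2) * u 1%nat = INR n ^ 2 /\
  forall m, (2 * INR (S (S m)) + INR n) * u (S (S m))
    = INR n * u (S m)
      - sum_f_R0 (fun i => (2 * INR i + 3) * u (S i)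
                           * (u (S (m - i)) - u (m - i)%nat)) m.

Lemma inverse_coef_exists (n : nat) : (1 <= n)%nat -> exists u, inverse_coef n u.
Proof.
intros Hn; apply le_INR in Hn; simpl (INR 1) in Hn.
destruct (course_of_values_rec (fun m f => match m with
  | O => INR n
  | 1%nat => INR n ^ 2 / (INR n + 2)
  | S (S m) => (INR n * f (S m) - sum_f_R0 (fun i => (2 * INR i + 3) * f (S i)
                 * (f (S (m - i)) - f (m - i)%nat)) m) / (2 * INR (S (S m)) + INR n)
  end)) as [u Hu].
- intros [|[|m]] f g Hfg; [reflexivity | reflexivity |].
  rewrite (Hfg (S m)) by lia; f_equal; f_equal.
  apply sum_eq; intros i Hi; now rewrite !Hfg by lia.
- exists u; repeat split.
  + now rewrite Hu.
  + rewrite Hu; field; lra.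
  + intros m; pose proof (pos_INR (S (S m))); rewrite (Hu (S (S m))).
    set (s := sum_f_R0 _ _); field; lra.
Qed.

(** The products x_i y_j with i + j <= N are among those with i, j <= N; the induction peels off
    x_0. *)
Lemma sum_PS_mult_le (x y : nat -> R) (N : nat) :
  (forall i, 0 <= x i) -> (forall i, 0 <= y i) ->
  sum_f_R0 (PS_mult x y) N <= sum_f_R0 x N * sum_f_R0 y N.
Proof.
intros Hx Hy; revert x Hx; induction N as [|N IH]; intros x Hx.
- unfold PS_mult; simpl; lra.
- assert (Hsplit : sum_f_R0 (PS_mult x y) (S N)
    = x 0%nat * sum_f_R0 y (S N) + sum_f_R0 (PS_mult (fun i => x (S i)) y) N).
  { rewrite !(decomp_sum _ (S N)) by lia; simpl pred.
    rewrite (sum_eq _ (fun i => y (S i) * x 0%nat + PS_mult (fun i => x (S i)) y i)).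
    - rewrite sum_plus, <- scal_sum; unfold PS_mult at 1; simpl; ring.
    - intros i Hi; unfold PS_mult; rewrite decomp_sum by lia; simpl; ring. }
  rewrite Hsplit, (decomp_sum x) by lia; simpl pred.
  specialize (IH (fun i => x (S i)) (fun i => Hx (S i))).
  assert (0 <= sum_f_R0 (fun i => x (S i)) N) by now apply cond_pos_sum.
  assert (sum_f_R0 y N <= sum_f_R0 y (S N)) by (simpl; specialize (Hy (S N)); lra).
  nra.
Qed.

(* The bound is preserved by the recursion: the weighted partial sum of order N + 1 is
   at most a constant plus a quadratic polynomial in that of order N, both small when
   the weight r is. *)
Lemma inverse_coef_bound (n : nat) (u : nat -> R) : (1 <= n)%nat -> inverse_coef n u ->
  forall N, sum_f_R0 (fun k => (2 * INR k + 3) * Rabs (u (S k))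
                               * (/ (32 * INR n)) ^ S k) N <= / 4.
Proof.
intros Hn (Hu0 & Hu1 & Hrec); apply le_INR in Hn; simpl (INR 1) in Hn.
(* Makes r u_0 = 1/32, uniformly in n. *)
set (r := / (32 * INR n)).
assert (Hr : 0 < r) by (apply Rinv_0_lt_compat; lra).
assert (Hrn : r * INR n = / 32) by (unfold r; field; lra).
(* The weight 2k + 3 is the factor in the convolution of the recursion, so that this convolution is
   dominated by t times [y] below. *)
set (t := fun k => (2 * INR k + 3) * Rabs (u (S k)) * r ^ S k).
assert (Ht0 : forall k, 0 <= t k).
{ intros k; unfold t; apply Rmult_le_pos; [|apply pow_le; lra].
  apply Rmult_le_pos; [pose proof (pos_INR k); lra | apply Rabs_pos]. }
assert (Ht1 : t 0%nat <= 3 / 32).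
{ unfold t; simpl INR; rewrite pow_1.
  assert (0 <= u 1%nat <= INR n) by (split; nra).
  rewrite Rabs_right by lra; nra. }
set (y := fun k => (Rabs (u (S k)) + Rabs (u k)) * r ^ S k).
assert (Hy0 : forall k, 0 <= y k).
{ intros k; unfold y; apply Rmult_le_pos; [|apply pow_le; lra].
  pose proof (Rabs_pos (u (S k))); pose proof (Rabs_pos (u k)); lra. }
assert (Hut : forall k, Rabs (u (S k)) * r ^ S k <= t k).
{ intros k; unfold t; rewrite Rmult_assoc.
  assert (0 <= Rabs (u (S k)) * r ^ S k)
    by (apply Rmult_le_pos; [apply Rabs_pos | apply pow_le; lra]).
  pose proof (pos_INR k); nra. }
assert (Hy : forall N, sum_f_R0 y N <= / 32 + (1 + r) * sum_f_R0 t N).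
{ intros N; assert (H1 : sum_f_R0 (fun k => Rabs (u (S k)) * r ^ S k) N <= sum_f_R0 t N)
    by (apply sum_Rle; intros; apply Hut).
  assert (H2 : sum_f_R0 (fun k => Rabs (u k) * r ^ S k) N <= / 32 + r * sum_f_R0 t N).
  { assert (H0 : Rabs (u 0%nat) * r ^ 1 = / 32)
      by (rewrite Hu0, Rabs_right, pow_1 by lra; lra).
    destruct N as [|N].
    - change (Rabs (u 0%nat) * r ^ 1 <= / 32 + r * t 0%nat).
      rewrite H0; specialize (Ht0 0%nat); nra.
    - rewrite decomp_sum, H0 by lia; simpl pred; apply Rplus_le_compat_l.
      apply Rle_trans with (r * sum_f_R0 t N).
      + rewrite scal_sum; apply sum_Rle; intros i _; specialize (Hut i).
        replace (Rabs (u (S i)) * r ^ S (S i)) with (Rabs (u (S i)) * r ^ S i * r)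
          by (simpl; ring).
        apply Rmult_le_compat_r; lra.
      + apply Rmult_le_compat_l; [lra|]; specialize (Ht0 (S N)); simpl; lra. }
  unfold y; rewrite (sum_eq _ (fun k => Rabs (u (S k)) * r ^ S k + Rabs (u k) * r ^ S k))
    by (intros; ring).
  rewrite sum_plus; lra. }
assert (Hstep : forall m, t (S m) <= / 32 * t m + PS_mult t y m).
{ intros m.
  (* The weight 2 (m + 1) + 3 is at most 2 (m + 2) + n as n >= 1, so the divisor of the recursion
     absorbs it. *)
  assert (H1 : t (S m) <= (2 * INR (S (S m)) + INR n) * Rabs (u (S (S m))) * r ^ S (S m)).
  { unfold t; apply Rmult_le_compat_r; [apply pow_le; lra|].
    apply Rmult_le_compat_r; [apply Rabs_pos|]; rewrite !S_INR; lra. }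
  apply Rle_trans with (1 := H1).
  assert (Hpos : 0 < 2 * INR (S (S m)) + INR n) by (pose proof (pos_INR (S (S m))); lra).
  rewrite <- (Rabs_right (2 * INR (S (S m)) + INR n)) at 1 by lra.
  rewrite <- Rabs_mult, Hrec.
  apply Rle_trans with ((INR n * Rabs (u (S m))
    + sum_f_R0 (fun i => Rabs ((2 * INR i + 3) * u (S i)
                             * (u (S (m - i)) - u (m - i)%nat))) m) * r ^ S (S m)).
  { apply Rmult_le_compat_r; [apply pow_le; lra|].
    unfold Rminus at 1; apply Rle_trans with (1 := Rabs_triang _ _).
    rewrite Rabs_Ropp, Rabs_mult, (Rabs_right (INR n)) by lra.
    apply Rplus_le_compat_l, Rsum_abs. }
  rewrite Rmult_plus_distr_r; apply Rplus_le_compat.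
  - specialize (Hut m); replace (INR n * Rabs (u (S m)) * r ^ S (S m)) with
      (r * INR n * (Rabs (u (S m)) * r ^ S m)) by (simpl; ring).
    rewrite Hrn; lra.
  - rewrite Rmult_comm, scal_sum; unfold PS_mult; apply sum_Rle; intros i Hi.
    unfold t, y; replace (r ^ S (S m)) with (r ^ S i * r ^ S (m - i))
      by (rewrite <- pow_add; f_equal; lia).
    pose proof (pos_INR i).
    rewrite !Rabs_mult, (Rabs_right (2 * INR i + 3)) by lra.
    assert (Rabs (u (S (m - i)) - u (m - i)%nat)
            <= Rabs (u (S (m - i))) + Rabs (u (m - i)%nat)).
    { unfold Rminus; apply Rle_trans with (1 := Rabs_triang _ _).
      rewrite Rabs_Ropp; lra. }
    replace ((2 * INR i + 3) * Rabs (u (S i)) * Rabs (u (S (m - i)) - u (m - i)%nat)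
             * (r ^ S i * r ^ S (m - i)))
      with ((2 * INR i + 3) * Rabs (u (S i)) * r ^ S i
             * (Rabs (u (S (m - i)) - u (m - i)%nat) * r ^ S (m - i))) by ring.
    apply Rmult_le_compat_l; [apply (Ht0 i)|].
    apply Rmult_le_compat_r; [apply pow_le; lra | assumption]. }
intros N; change (sum_f_R0 t N <= / 4).
induction N as [|N IH]; [simpl; lra|].
rewrite decomp_sum by lia; simpl pred.
assert (H1 : sum_f_R0 (fun i => t (S i)) N
  <= / 32 * sum_f_R0 t N + sum_f_R0 t N * sum_f_R0 y N).
{ apply Rle_trans with (sum_f_R0 (fun i => t i * / 32 + PS_mult t y i) N).
  - apply sum_Rle; intros i _; specialize (Hstep i); lra.
  - rewrite sum_plus, <- scal_sum; apply Rplus_le_compat_l; now apply sum_PS_mult_le. }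
specialize (Hy N); assert (0 <= sum_f_R0 t N) by now apply cond_pos_sum.
(* For a sum s <= 1/4 of order N, the next one is at most 3/32 + s/32 + s (1/32 + 33 s/32) <= 89/512
   < 1/4. *)
assert (Hr32 : r <= / 32) by nra.
assert (sum_f_R0 y N <= / 32 + (1 + / 32) * / 4) by nra.
nra.
Qed.

Lemma CV_radius_inverse_coef (n : nat) (u : nat -> R) : (1 <= n)%nat ->
  inverse_coef n u -> Rbar_lt 0 (CV_radius u).
Proof.
intros Hn Hu; pose proof (inverse_coef_bound n u Hn Hu) as Hb.
apply le_INR in Hn; simpl (INR 1) in Hn.
set (r := / (32 * INR n)) in *.
assert (Hr : 0 < r) by (apply Rinv_0_lt_compat; lra).
apply Rbar_lt_le_trans with r; [exact Hr|].
apply CV_radius_ge_of_bounded with (INR n); intros [|k].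
- rewrite (proj1 Hu), Rmult_1_r, Rabs_right; lra.
- apply Rle_trans with (/ 4); [|lra].
  assert (Hr' : forall j, 0 < r ^ j) by (intros; now apply pow_lt).
  rewrite Rabs_mult, (Rabs_right (r ^ S k)) by (left; apply Hr').
  apply Rle_trans with (2 := Hb k).
  assert (Ht : forall j, 0 <= Rabs (u (S j)) * r ^ S j
             <= (2 * INR j + 3) * Rabs (u (S j)) * r ^ S j).
  { intros j; rewrite (Rmult_assoc (2 * INR j + 3)).
    assert (0 <= Rabs (u (S j)) * r ^ S j)
      by (apply Rmult_le_pos; [apply Rabs_pos | left; apply Hr']).
    pose proof (pos_INR j); nra. }
  destruct k as [|k]; [apply Ht|]; rewrite tech5.
  assert (0 <= sum_f_R0 (fun j => (2 * INR j + 3) * Rabs (u (S j)) * r ^ S j) k).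
  { apply cond_pos_sum; intros j; specialize (Ht j); lra. }
  specialize (Ht (S k)); lra.
Qed.

Lemma inverse_ode (n : nat) (u : nat -> R) : (1 <= n)%nat -> inverse_coef n u ->
  locally 0 (fun w =>
    (PSeries u w + 2 * (w * PSeries (PS_derive u) w))
    * (PSeries u w * (1 - w) - (INR n - 1)) = PSeries u w).
Proof.
intros Hn Hu; pose proof (CV_radius_inverse_coef n u Hn Hu) as Hr.
destruct Hu as (H0 & H1 & H2).
pose proof (pseries_at0_PSeries u Hr) as HU.
assert (HU' : pseries_at0 (PSeries (PS_derive u)) (PS_derive u))
  by (apply pseries_at0_PSeries; now rewrite CV_radius_derive).
set (v := fun k => u k + 2 * PS_incr_n (PS_derive u) 1 k).
set (y := fun k => u k - PS_incr_n u 1 k - (INR n - 1) * PS_one k).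
assert (HV : pseries_at0 (fun w => PSeries u w + 2 * (w ^ 1 * PSeries (PS_derive u) w)) v)
  by exact (pseries_at0_plus _ _ _ _ HU
              (pseries_at0_scal 2 _ _ (pseries_at0_incr_n _ _ 1 HU'))).
assert (HW : pseries_at0
    (fun w => PSeries u w - w ^ 1 * PSeries u w - (INR n - 1) * 1) y)
  by exact (pseries_at0_minus _ _ _ _
              (pseries_at0_minus _ _ _ _ HU (pseries_at0_incr_n _ _ 1 HU))
              (pseries_at0_scal (INR n - 1) _ _ pseries_at0_1)).
assert (Hv : forall k, v k = (2 * INR k + 1) * u k).
{ intros [|k]; unfold v; cbn [PS_incr_n PS_incr_1].
  - change zero with 0; simpl; ring.
  - unfold PS_derive; rewrite S_INR; ring. }
assert (Hy0 : y 0%nat = 1).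
{ unfold y; cbn [PS_incr_n PS_incr_1 PS_one]; change zero with 0; rewrite H0; ring. }
assert (HyS : forall k, y (S k) = u (S k) - u k).
{ intros k; unfold y; cbn [PS_incr_n PS_incr_1 PS_one]; ring. }
assert (Heq : forall k, PS_mult v y k = u k).
{ intros [|[|m]]; unfold PS_mult.
  - simpl; rewrite Hv, Hy0; simpl; ring.
  - simpl; rewrite !Hv, Hy0, HyS, H0; simpl; lra.
  (* The two end terms carry u_{m+2}: v_{m+2} y_0 + v_0 y_{m+2} = (2 (m + 2) + 1 + n) u_{m+2} - n
     u_{m+1}. Subtracting the right side u_{m+2} leaves the divisor of the recursion. *)
  - rewrite tech5, decomp_sum by lia; simpl pred.
    rewrite Nat.sub_diag, Nat.sub_0_r, Hy0, HyS, !Hv, H0.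
    rewrite (sum_eq _ (fun i => (2 * INR i + 3) * u (S i)
                             * (u (S (m - i)) - u (m - i)%nat))).
    + specialize (H2 m); simpl (INR 0); lra.
    + intros i Hi; rewrite Hv, S_INR.
      replace (S (S m) - S i)%nat with (S (m - i)) by lia; rewrite HyS; ring. }
generalize (proj2 (pseries_at0_mult _ _ _ _ HV HW)); apply filter_imp.
intros w Hw; rewrite (PSeries_ext _ u w Heq) in Hw.
rewrite <- Hw at 3; ring.
Qed.

(** * The series u as the inverse of A near 0 *)

Lemma continuous_PSeries_a (n : nat) : (1 <= n)%nat -> continuous (PSeries (a_ n)) 0.
Proof.
intros Hn; apply continuous_PSeries_0, Rbar_lt_le_trans with (2 := CV_radius_a n Hn).
exact Rlt_0_1.
Qed.

Definition A_sqr (n : nat) (z : R) : R := z * (PSeries (a_ n) z * PSeries (a_ n) z).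

Lemma locally_A_sqr (n : nat) (Q : R -> Prop) : (1 <= n)%nat ->
  locally 0 Q -> locally 0 (fun z => Q (A_sqr n z)).
Proof.
intros Hn HQ; pose proof (continuous_PSeries_a n Hn) as Hh.
assert (Hc : continuous (A_sqr n) 0).
{ apply (continuous_mult (K := R_AbsRing) (fun z => z)); [apply continuous_id|].
  now apply (continuous_mult (K := R_AbsRing)). }
apply Hc; unfold A_sqr; now rewrite Rmult_0_l.
Qed.

(* With h the series of the [a_j], w = z h^2 and U the series of u, the error
   E = h U(w) - 1 solves 2 z E' = -(U + 2 w U')(w) (1 - w) E, hence vanishes. *)
Lemma inverse_pseries (n : nat) (u : nat -> R) : (1 <= n)%nat -> inverse_coef n u ->
  locally 0 (fun z => 0 <= z -> PSeries (a_ n) z * PSeries u (A_sqr n z) = 1).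
Proof.
intros Hn Hu; pose proof (CV_radius_inverse_coef n u Hn Hu) as Hr.
set (h := PSeries (a_ n)); set (h' := PSeries (PS_derive (a_ n))).
set (U := PSeries u); set (U' := PSeries (PS_derive u)).
set (V := fun w => U w + 2 * (w * U' w)).
assert (HV : locally 0 (fun w => 0 < V w)).
{ apply locally_gt_of_continuous.
  - assert (HU' : continuous U' 0)
      by (apply continuous_PSeries_0; now rewrite CV_radius_derive).
    apply (continuous_plus (V := R_NormedModule) U); [now apply continuous_PSeries_0|].
    apply (continuous_scal_r (V := R_NormedModule) 2).
    apply (continuous_mult (K := R_AbsRing) (fun z => z)); [apply continuous_id | exact HU'].
  - unfold V, U; rewrite PSeries_0, (proj1 Hu), Rmult_0_l, Rmult_0_r, Rplus_0_r.
    apply lt_0_INR; lia. }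
pose proof (locally_A_sqr n _ Hn (filter_and _ _ (filter_and _ _ HV (inverse_ode n u Hn Hu))
  (filter_and _ _ (locally_Rabs_lt _ Hr) (locally_Rabs_lt 1 Rlt_0_1)))) as Hw.
destruct (locally_0_Rabs _ (filter_and _ _ Hw (locally_Rabs_lt 1 Rlt_0_1))) as [d Hd].
clear Hw HV.
exists d; intros z Hz Hz0.
change (Rabs (z - 0) < d) in Hz; rewrite Rminus_0_r, Rabs_right in Hz by lra.
apply Rminus_diag_uniq.
set (w := A_sqr n) in *.
set (w' := fun z => 1 * (h z * h z) + z * (h' z * h z + h z * h' z)).
apply (singular_ode_zero (fun z => h z * U (w z) - 1)
  (fun z => h' z * U (w z) + h z * (w' z * U' (w z)))
  (fun z => V (w z) * (1 - w z) / 2) d); [| | |lra].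
- unfold w, A_sqr; rewrite Rmult_0_l; unfold h, U; rewrite !PSeries_0, a_0, (proj1 Hu).
  field; apply not_0_INR; lia.
- intros x Hx; destruct (Hd x) as [[_ [Hwr _]] Hx1]; [rewrite Rabs_right; lra|].
  simpl in Hx1.
  assert (Hh : is_derive h x (h' x)).
  { apply is_derive_PSeries; apply Rbar_lt_CV_radius; [now apply CV_radius_a | exact Hx1]. }
  assert (Hw : is_derive w x (w' x)).
  { unfold w, A_sqr, w'; fold h.
    apply (is_derive_mult (K := R_AbsRing) (fun z => z) (fun z => h z * h z)).
    - exact (is_derive_id (K := R_AbsRing) x).
    - apply (is_derive_mult (K := R_AbsRing) h h); [exact Hh | exact Hh |].
      intros; apply Rmult_comm.
    - intros; apply Rmult_comm. }
  evar_last.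
  + apply (is_derive_minus (V := R_NormedModule) (fun z => h z * U (w z)) (fun _ => 1)).
    * apply (is_derive_mult (K := R_AbsRing) h (fun z => U (w z))); [exact Hh | |].
      -- apply (is_derive_comp U w); [apply is_derive_PSeries, Hwr | exact Hw].
      -- intros; apply Rmult_comm.
    * apply is_derive_const.
  + unfold minus, plus, opp, mult, scal, zero; simpl; unfold mult; simpl; fold (U' (w x)); ring.
- intros x Hx; destruct (Hd x) as [[[HV Hode] [_ Hw1]] Hx1]; [rewrite Rabs_right; lra|].
  simpl in Hx1, Hw1; apply Rabs_def2 in Hw1.
  split; [apply Rmult_le_pos; [apply Rmult_le_pos; lra | lra]|].
  pose proof (PSeries_a_riccati n x Hn Hx1) as H1; fold h h' in H1.
  fold U U' in Hode; change (V (w x) * (U (w x) * (1 - w x) - (INR n - 1)) = U (w x)) in Hode.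
  assert (Hwx : w x = x * (h x * h x)) by reflexivity.
  assert (H3 : x * h' x = (1 - INR n * h x - w x) / 2) by lra.
  replace (x * (h' x * U (w x) + h x * (w' x * U' (w x))))
    with (x * h' x * U (w x)
          + U' (w x) * (h x * (x * (h x * h x)) + 2 * (x * (h x * h x)) * (x * h' x)))
    by (unfold w'; ring).
  rewrite <- Hwx, H3.
  apply Rminus_diag_uniq.
  (* The defect of the equation for E is h/2 times the defect of the equation for U at w(x). *)
  transitivity (h x / 2 * (V (w x) * (U (w x) * (1 - w x) - (INR n - 1)) - U (w x))).
  + unfold V; field.
  + rewrite Hode; ring.
Qed.

(** * Coefficients of the even powers of A *)

Lemma BesselA_pow_even (n j : nat) : (2 <= n)%nat ->
  locally 0 (fun x => BesselA n x ^ (2 * j) = A_sqr n (x ^ 2) ^ j).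
Proof.
intros Hn; generalize (BesselA_pseries n Hn); apply filter_imp; intros x ->.
rewrite pow_mult; f_equal; unfold A_sqr; ring.
Qed.

(** Extracting z^j displays that A^(2j) starts at order j with coefficient b_1^j, which makes the
    linear system for the c_l triangular. *)
Lemma A_sqr_pow_pseries (n j : nat) : (1 <= n)%nat ->
  pseries_at0 (fun z => A_sqr n z ^ j)
    (PS_incr_n (PS_pow (PS_mult (a_ n) (a_ n)) j) j).
Proof.
intros Hn.
assert (Ha : pseries_at0 (PSeries (a_ n)) (a_ n)).
{ apply pseries_at0_PSeries, Rbar_lt_le_trans with (2 := CV_radius_a n Hn).
  exact Rlt_0_1. }
generalize (pseries_at0_incr_n _ _ j (pseries_at0_pow _ _ j (pseries_at0_mult _ _ _ _ Ha Ha))).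
apply pseries_at0_ext; [|reflexivity].
apply filter_forall; intros x; apply Rpow_mult_distr.
Qed.

Lemma coef0_BesselA_pow (n j l : nat) : (2 <= n)%nat ->
  coef0 (fun x => BesselA n x ^ (2 * j)) (2 * l)
  = PS_incr_n (PS_pow (PS_mult (a_ n) (a_ n)) j) j l.
Proof.
intros Hn; destruct (A_sqr_pow_pseries n j) as [Hr He]; [lia|].
apply coef0_even; [exact Hr|].
generalize (filter_and _ _ (BesselA_pow_even n j Hn) (locally_sqr _ He)).
apply filter_imp; intros x [-> ->]; reflexivity.
Qed.

Lemma PS_mult_one_r (a : nat -> R) (k : nat) : PS_mult a PS_one k = a k.
Proof.
unfold PS_mult; destruct k as [|k]; [simpl; ring|].
rewrite tech5, Nat.sub_diag; simpl PS_one at 2.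
rewrite (sum_eq _ (fun _ => 0)).
- rewrite sum_cte; ring.
- intros i Hi; replace (S k - i)%nat with (S (k - i)) by lia; apply Rmult_0_r.
Qed.

Lemma b_eq (n k : nat) : (2 <= n)%nat -> b_ n (S k) = PS_mult (a_ n) (a_ n) k.
Proof.
intros Hn; change (b_ n (S k)) with (coef0 (fun x => BesselA n x ^ (2 * 1)) (2 * S k)).
rewrite coef0_BesselA_pow by exact Hn; apply PS_mult_one_r.
Qed.

Lemma CV_radius_decr_n (a : nat -> R) (m : nat) : CV_radius (PS_decr_n a m) = CV_radius a.
Proof.
induction m as [|m IH]; [reflexivity|].
rewrite <- IH, <- (CV_radius_decr_1 (PS_decr_n a m)).
apply CV_radius_ext; intros k; unfold PS_decr_n, PS_decr_1; f_equal; lia.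
Qed.

Lemma locally_bounded_of_continuous (f : R -> R) : continuous f 0 ->
  locally 0 (fun x => Rabs (f x) <= Rabs (f 0) + 1).
Proof.
intros Hf; apply (Hf (fun y => Rabs y <= Rabs (f 0) + 1)).
exists (mkposreal 1 Rlt_0_1); intros y Hy; change (Rabs (y - f 0) < 1) in Hy.
pose proof (Rabs_triang_inv y (f 0)); lra.
Qed.

(* z minus the l-th partial sum is O(z^(l+1)), so its coefficient of order l vanishes. *)
Lemma inverse_coef_convolution (n l : nat) (c : nat -> R) : (1 <= n)%nat -> (2 <= l)%nat ->
  Rbar_lt 0 (CV_radius c) ->
  locally 0 (fun z => 0 <= z -> PSeries c (A_sqr n z) = z) ->
  sum_f_R0 (fun j => c j * PS_incr_n (PS_pow (PS_mult (a_ n) (a_ n)) j) j l) l = 0.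
Proof.
intros Hn Hl Hr Hc.
pose proof (pseries_at0_minus _ _ _ _ (pseries_at0_incr_n _ _ 1 pseries_at0_1)
  (pseries_at0_sum _ _ l (fun j => pseries_at0_scal (c j) _ _ (A_sqr_pow_pseries n j Hn)))) as Hf.
set (K := PSeries (PS_decr_n c (S l))); set (h := PSeries (a_ n)).
assert (Hz := fun M HM => pseries_at0_order (S l) _ _ M Hf HM l (Nat.lt_succ_diag_r l)).
(* As l >= 2, the term z contributes 0 at order l. *)
cbv beta in Hz; destruct l as [|[|l]]; [lia | lia |].
cbn [PS_incr_n PS_incr_1 PS_one] in Hz.
enough (Hgoal : exists M, locally 0 (fun x => 0 < x -> Rabs (x ^ 1 * 1
  - sum_f_R0 (fun j => c j * A_sqr n x ^ j) (S (S l))) <= M * x ^ S (S (S l)))).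
{ destruct Hgoal as [M HM]; specialize (Hz M HM); lra. }
clear Hz Hf; set (L := S (S l)) in *.
(* The remainder is w^(L+1) K(w) with w = z h(z)^2; near 0, |h| and |K| exceed their values at 0 by
   at most 1. *)
exists (((Rabs (h 0) + 1) * (Rabs (h 0) + 1)) ^ S L * (Rabs (K 0) + 1)).
assert (HK : continuous K 0)
  by (apply continuous_PSeries_0; now rewrite CV_radius_decr_n).
generalize (filter_and _ _ (filter_and _ _ Hc
    (locally_bounded_of_continuous _ (continuous_PSeries_a n Hn)))
  (locally_A_sqr n _ Hn (filter_and _ _ (locally_bounded_of_continuous _ HK)
    (locally_Rabs_lt _ Hr)))).
apply filter_imp; intros x [[H1 H2] [H3 H4]] Hx; fold h in H2.
specialize (H1 (Rlt_le _ _ Hx)).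
rewrite (PSeries_decr_n _ L) in H1 by now apply CV_radius_inside.
fold K in H1.
replace (x ^ 1 * 1 - _) with (A_sqr n x ^ S L * K (A_sqr n x)) by (rewrite <- H1 at 3; ring).
rewrite Rabs_mult, <- RPow_abs; unfold A_sqr at 1; fold h.
rewrite !Rabs_mult, (Rabs_right x), Rpow_mult_distr by lra.
pose proof (Rabs_pos (h x)); pose proof (Rabs_pos (K (A_sqr n x))).
assert (H5 : (Rabs (h x) * Rabs (h x)) ^ S L
             <= ((Rabs (h 0) + 1) * (Rabs (h 0) + 1)) ^ S L)
  by (apply pow_incr; split; nra).
assert (0 <= (Rabs (h x) * Rabs (h x)) ^ S L) by (apply pow_le; nra).
rewrite Rmult_assoc, (Rmult_comm _ (x ^ S L)).
apply Rmult_le_compat_l; [apply pow_le; lra|].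
now apply Rmult_le_compat.
Qed.

Theorem theorem4p1 (n : nat) (hn : (2 <= n)%nat) :
  exists (rho : R) (c : nat -> R),
    0 < rho /\ Rbar_le (Finite rho) (radius_A n) /\
    (forall kappa : R, 0 < kappa < rho ->
       is_series (fun l : nat => c (S l) * BesselA n kappa ^ (2 * S l)) (kappa ^ 2)) /\
    (forall k : nat, (1 <= k)%nat ->
       b_ n k = sum_n (fun i : nat => a_ n i * a_ n (k - 1 - i)%nat) (k - 1)) /\
    c 1%nat = 1 / b_ n 1 /\
    1 / b_ n 1 = INR n ^ 2 /\
    (forall l : nat, (2 <= l)%nat ->
       c l = - (1 / b_ n 1 ^ l)
             * sum_n_m (fun j : nat =>
                 c j * coef0 (fun kappa : R => BesselA n kappa ^ (2 * j)) (2 * l))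
                 1 (l - 1)).
Proof.
assert (Hn1 : (1 <= n)%nat) by lia.
assert (Hn0 : INR n <> 0) by (apply not_0_INR; lia).
destruct (inverse_coef_exists n Hn1) as [u Hu].
pose proof (CV_radius_inverse_coef n u Hn1 Hu) as Hr.
pose proof (pseries_at0_PSeries u Hr) as HU.
(* Coefficients of w u(w)^2; the shift makes c_0 = 0, so the series effectively starts at l = 1. *)
set (c := PS_incr_1 (PS_mult u u)).
assert (Hrc : Rbar_lt 0 (CV_radius c))
  by (unfold c; rewrite CV_radius_incr_1; apply (pseries_at0_mult _ _ _ _ HU HU)).
assert (Hinv : locally 0 (fun z => 0 <= z ->
    Rbar_lt (Rabs (A_sqr n z)) (CV_radius u) /\
    A_sqr n z * (PSeries u (A_sqr n z) * PSeries u (A_sqr n z)) = z)).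
{ generalize (filter_and _ _ (inverse_pseries n u Hn1 Hu)
    (locally_A_sqr n _ Hn1 (locally_Rabs_lt _ Hr))).
  apply filter_imp; intros z [H1 H2] Hz; split; [exact H2|]; specialize (H1 Hz).
  unfold A_sqr at 1.
  transitivity (z * ((PSeries (a_ n) z * PSeries u (A_sqr n z))
                     * (PSeries (a_ n) z * PSeries u (A_sqr n z)))); [ring|].
  rewrite H1; ring. }
assert (Hb1 : b_ n 1 = 1 / INR n ^ 2).
{ rewrite b_eq by exact hn; unfold PS_mult; simpl; rewrite a_0; field; exact Hn0. }
destruct (locally_0_Rabs _ (filter_and _ _ (BesselA_pseries n hn) (locally_sqr _ Hinv)))
  as [d Hd].
(* Below d the local identities hold, and 1 is a lower bound for R_n. *)
exists (Rmin d 1), c; repeat split.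
- apply Rmin_pos; [apply cond_pos | lra].
- apply Rbar_le_trans with (2 := radius_A_ge1 n Hn1); apply Rmin_r.
- intros kappa [Hk0 Hk]; pose proof (Rmin_l d 1).
  destruct (Hd kappa) as [HA Hi]; [rewrite Rabs_right; lra|].
  destruct (Hi (pow2_ge_0 kappa)) as [Hw Hk2]; clear Hi.
  set (w := A_sqr n (kappa ^ 2)) in *.
  rewrite <- Hk2.
  assert (Hs : is_pseries (PS_mult u u) w (PSeries u w * PSeries u w)).
  { apply is_pseries_mult; try exact Hw; now apply PSeries_correct, CV_radius_inside. }
  apply is_series_ext with (2 := is_series_scal_l w _ _ Hs); intros l.
  rewrite pow_mult, HA.
  replace ((kappa * PSeries (a_ n) (kappa ^ 2)) ^ 2) with w by (unfold w, A_sqr; ring).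
  unfold c; cbn [PS_incr_1]; rewrite pow_n_pow; unfold scal; simpl; unfold mult; simpl; ring.
- intros [|k] Hk; [lia|]; rewrite b_eq by exact hn; rewrite sum_n_Reals.
  replace (S k - 1)%nat with k by lia; reflexivity.
- rewrite Hb1; unfold c; cbn [PS_incr_1]; unfold PS_mult; simpl.
  rewrite (proj1 Hu); field; exact Hn0.
- rewrite Hb1; field; exact Hn0.
- intros l Hl.
  assert (Hz := inverse_coef_convolution n l c Hn1 Hl Hrc).
  rewrite (sum_n_m_ext _ (fun j => c j * PS_incr_n (PS_pow (PS_mult (a_ n) (a_ n)) j) j l))
    by (intros j; now rewrite coef0_BesselA_pow by exact hn).
  rewrite <- sum_n_Reals in Hz; unfold sum_n in Hz.
  destruct l as [|l]; [lia|]; replace (S l - 1)%nat with l by lia.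
  (* The convolution splits into j = 0, killed by c_0 = 0, the sum of the recursion, and the top
     term c_l b_1^l, which is solved for c_l. *)
  rewrite sum_Sn_m, sum_n_Sm in Hz by lia.
  rewrite (PS_incr_n_simplify _ (S l) (S l)) in Hz.
  destruct (Compare_dec.le_lt_dec (S l) (S l)) as [_ | ?]; [|lia].
  rewrite Nat.sub_diag, PS_pow_0 in Hz.
  replace (PS_mult (a_ n) (a_ n) 0) with (b_ n 1) in Hz by now apply b_eq.
  set (s := sum_n_m _ 1 l) in *.
  assert (Hc0 : c 0%nat = 0) by reflexivity.
  assert (Hbl : b_ n 1 ^ S l <> 0).
  { apply pow_nonzero; rewrite Hb1; apply Rgt_not_eq, Rdiv_lt_0_compat; [lra|].
    apply pow2_gt_0, Hn0. }
  apply (Rmult_eq_reg_r (b_ n 1 ^ S l)); [|exact Hbl].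
  replace (- (1 / b_ n 1 ^ S l) * s * b_ n 1 ^ S l) with (- s) by (field; exact Hbl).
  enough (plus (c 0%nat * PS_incr_n (PS_pow (PS_mult (a_ n) (a_ n)) 0) 0 (S l))
            (plus s (c (S l) * b_ n 1 ^ S l)) = 0) as He
    by (rewrite Hc0, Rmult_0_l in He; change plus with Rplus in He; cbv beta in He; lra).
  apply Hz; revert Hinv; apply filter_imp; intros z Hi Hz0.
  destruct (Hi Hz0) as [Hw Hzz]; unfold c.
  now rewrite PSeries_incr_1, PSeries_mult by exact Hw.
Qed.
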